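(* Let $\lambda$ be a signature with $N$ parts, and let $\mathbf x=(x_1,\ldots,x_N)$, $\mathbf r=(r_1,\ldots,r_N)$, $\mathbf y=(y_1,y_2,\ldots)$, $\mathbf s=(s_1,s_2,\ldots)$ be complex variables. Then $$F_\lambda(\mathbf x;\mathbf y;\mathbf r;\mathbf s)=\frac{\prod_{1\le i\le j\le N}(r_i^{-2}x_i-x_j)}{\prod_{1\le i<j\le N}(x_i-x_j)}\,\det\left[\varphi_{\lambda_j+N-j}(x_i\mid\mathbf y;\mathbf s)\right]_{i,j=1}^N,$$ where $$\varphi_k(x\mid\mathbf y;\mathbf s)=\frac1{y_{k+1}-x}\prod_{j=1}^k\frac{x-s_j^{-2}y_j}{x-y_j},\qquad k\ge0.$$
   Context: Signatures. A signature with $N$ parts is an integer sequence $\lambda=(\lambda_1\ge\ldots\ge\lambda_N\ge0)$; $\mathcal S(\lambda)=\{\lambda_j+N+1-j:1\le j\le N\}\subset\mathbb Z_{\ge1}$. Vertex weights. For $i_1,j_1,i_2,j_2\in\{0,1\}$ (numbers of paths entering from the bottom, entering from the left, exiting at the top, exiting to the right) put $\widehat W(\cdot)=\widehat W(\cdot\mid x;y;r;s)$ with $\widehat W(0,0;0,0)=\frac{s^{-2}y-x}{y-x}$, $\widehat W(1,1;1,1)=\frac{r^{-2}x-y}{y-x}$, $\widehat W(1,0;1,0)=\frac{s^{-2}y-r^{-2}x}{y-x}$, $\widehat W(0,1;0,1)=1$, $\widehat W(1,0;0,1)=\frac{x(r^{-2}-1)}{y-x}$, $\widehat W(0,1;1,0)=\frac{y(s^{-2}-1)}{y-x}$,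 and $\widehat W=0$ otherwise. Partition function. A configuration on $\mathbb Z_{\ge1}\times\{1,\ldots,N\}$ consists of vertical edge states $v(i,j)\in\{0,1\}$ ($i\ge1$, $0\le j\le N$; $v(i,j-1)$ is below and $v(i,j)$ above the vertex $(i,j)$) and horizontal edge states $h(i,j)\in\{0,1\}$ ($i\ge0$, $1\le j\le N$; $h(i-1,j)$ is to the left and $h(i,j)$ to the right of $(i,j)$). For $\lambda$ with $N$ parts, $F_\lambda(\mathbf x;\mathbf y;\mathbf r;\mathbf s)$ is the sum over configurations with $v(i,0)=\mathbf 1_{i\in\mathcal S(\lambda)}$, $v(i,N)=0$, $h(0,j)=0$, and $h(i,j)=1$ for all large $i$, of $\prod_{i\ge1}\prod_{j=1}^N\widehat W(v(i,j-1),h(i-1,j);v(i,j),h(i,j)\mid x_j;y_i;r_j;s_i)$. The sum has finitely many nonzero terms, and in each of them all but finitely many factors equal $1$. The identity is between rational functions: parameters are assumed such that no denominator vanishes. *)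

(* Defs.v *)
From mathcomp Require Import all_boot all_order all_algebra.
From mathcomp Require Import boolp classical_sets functions cardinality fsbigop.
From mathcomp Require Import topology.
Set Implicit Arguments.
Unset Strict Implicit.
Unset Printing Implicit Defensive.
Import GRing.Theory.
Local Open Scope ring_scope.
Local Open Scope classical_set_scope.

(* Indices start at 0: for [i : nat], [y i] and [s i] are the parameters
   $y_{i+1}$, $s_{i+1}$ of column $i+1$; for [j : 'I_N], [tnth lam j], [x j],
   [r j] are $\lambda_{j+1}$, $x_{j+1}$, $r_{j+1}$. *)

Definition is_signature (N : nat) (lam : N.-tuple nat) : bool := sorted geq lam.

(* The 0-based [N - j] is $N + 1 - (j+1)$: elements are the actual (positive)
   column numbers. *)
Definition sigset (N : nat) (lam : N.-tuple nat) : set nat :=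
  [set p | exists j : 'I_N, p = (tnth lam j + N - j)%N].

(* Arguments: path numbers at the bottom, left, top and right edges. *)
Definition What (F : fieldType) (i1 j1 i2 j2 : bool) (x y r s : F) : F :=
  match i1, j1, i2, j2 with
  | false, false, false, false => (s ^- 2 * y - x) / (y - x)
  | true, true, true, true => (r ^- 2 * x - y) / (y - x)
  | true, false, true, false => (s ^- 2 * y - r ^- 2 * x) / (y - x)
  | false, true, false, true => 1
  | true, false, false, true => x * (r ^- 2 - 1) / (y - x)
  | false, true, true, false => y * (s ^- 2 - 1) / (y - x)
  | _, _, _, _ => 0
  end.

(* For [c : config N], [c.1 i j] is the vertical edge $v(i+1,j)$ with
   $0 \le j \le N$, and [c.2 i j] the horizontal edge $h(i,j+1)$. *)
Definition config (N : nat) : Type :=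
  ((nat -> 'I_N.+1 -> bool) * (nat -> 'I_N -> bool))%type.

Definition boundary (N : nat) (lam : N.-tuple nat) : set (config N) :=
  [set c : config N | [/\ forall i, c.1 i ord0 <-> sigset lam i.+1,
               forall i, c.1 i ord_max = false,
               forall j, c.2 0%N j = false
             & \forall i \near \oo, forall j, c.2 i j = true]].

(* [p = (i, j)] is the vertex in column $i+1$ and row $j+1$. *)
Definition vertex_weight (F : fieldType) (N : nat) (x : 'I_N -> F)
    (y : nat -> F) (r : 'I_N -> F) (s : nat -> F) (c : config N)
    (p : nat * 'I_N) : F :=
  What (c.1 p.1 (widen_ord (leqnSn N) p.2)) (c.2 p.1 p.2)
       (c.1 p.1 (lift ord0 p.2)) (c.2 p.1.+1 p.2)
       (x p.2) (y p.1) (r p.2) (s p.1).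

(* An infinite product with a zero factor is 0. This case is separate because
   the big operator returns 1 when infinitely many factors differ from 1. *)
Definition config_weight (F : fieldType) (N : nat) (x : 'I_N -> F)
    (y : nat -> F) (r : 'I_N -> F) (s : nat -> F) (c : config N) : F :=
  if `[< exists p, vertex_weight x y r s c p = 0 >] then 0
  else \big[*%R/1]_(p \in [set: nat * 'I_N]) vertex_weight x y r s c p.

(* [\sum_(c \in A)] is the sum over the nonzero terms, which are finitely
   many here. *)
Definition partition_fun (F : fieldType) (N : nat) (lam : N.-tuple nat)
    (x : 'I_N -> F) (y : nat -> F) (r : 'I_N -> F) (s : nat -> F) : F :=
  \sum_(c \in boundary lam) config_weight x y r s c.

(* [y k] is $y_{k+1}$, and the product runs over $j = 1, \dots, k$. *)
Definition phi (F : fieldType) (k : nat) (x : F) (y s : nat -> F) : F :=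
  (y k - x)^-1 * \prod_(j < k) ((x - s j ^- 2 * y j) / (x - y j)).

(* Main.v *)
Require Import Defs.
From mathcomp Require Import all_boot all_order all_algebra.
From mathcomp Require Import boolp classical_sets functions fsbigop topology.
From mathcomp Require Import reals complex.
From mathcomp Require Import ring zify.
Set Implicit Arguments.
Unset Strict Implicit.
Unset Printing Implicit Defensive.
Import GRing.Theory.
Local Open Scope ring_scope.

(* The partition function is summed one row at a time, from the bottom. Read the
   top edges of a row as a wedge product of the column vectors v_q = (phi_q(x_i)),
   where x_i ranges over the rows above. Write x, r for the parameters of the
   row, D for the diagonal operator with entries (r^-2 x - x_i) / (x_i - x), and
   u_m for the vector with entries pi_m(x_i) / (x_i - x), where
   pi_m(z) = prod_(j < m) (z - s_j^-2 y_j) / (z - y_j).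
   Scanning the columns from left to right, the partial sum of the row over the
   first m columns is, up to signs and when the horizontal path is present, the
   contraction of the wedge of the D v_p, p running over the bottom positions,
   with x (r^-2 - 1) phi_p(x); when it is absent, the sum is pi_m(x) times the
   wedge of the D v_p plus u_m wedged with that contraction.
   The induction step is the free fermion relation between the six weights.
   At the end of the row, the contraction is the Laplace expansion, along x, of
   a determinant with one more row, times det D. *)

(** * Alternating forms on lists of vectors *)

Definition decr_positions (P : nat -> bool) (m : nat) : seq nat :=
  [seq i <- rev (iota 0 m) | P i].

Lemma decr_positionsS P m :
  decr_positions P m.+1 =
  if P m then m :: decr_positions P m else decr_positions P m.
Proof. by rewrite /decr_positions -addn1 iotaD rev_cat add0n. Qed.

(** A wedge is represented by its values under all such [G], so no exterior algebra is built. [G]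
    accepts lists of every length: it is a family with one form per length. *)
Definition alternating_form (F : fieldType) (V : lmodType F) (G : seq V -> F) :=
  (forall l1 l2 k u v,
     G (l1 ++ (k *: u + v) :: l2) = k * G (l1 ++ u :: l2) + G (l1 ++ v :: l2))
  /\ (forall l1 l2 u, G (l1 ++ u :: u :: l2) = 0).

Section AlternatingForms.
Variables (F : fieldType) (V : lmodType F) (G : seq V -> F).
Hypothesis altG : alternating_form G.

Lemma alternating_form_cons v : alternating_form (fun l => G (v :: l)).
Proof.
by case: altG => lin alt; split=> [l1|l1] *; rewrite -!cat_cons ?lin ?alt.
Qed.

Lemma alternating_formD l k1 k2 u v :
  G ((k1 *: u + k2 *: v) :: l) = k1 * G (u :: l) + k2 * G (v :: l).
Proof.
have lin := altG.1 [::] l; rewrite /= in lin.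
have G0 : G (0 :: l) = 0.
  have := lin 1 0 0; rewrite scaler0 addr0 mul1r => GE.
  by apply: (@addrI _ (G (0 :: l))); rewrite addr0 -GE.
by rewrite lin -(addr0 (k2 *: v)) lin G0 addr0.
Qed.

End AlternatingForms.

Lemma alternating_form_comb2 (F : fieldType) (V : lmodType F) (G : seq V -> F)
    (altG : alternating_form G) l a b c d u v :
  G ((a *: u + b *: v) :: (c *: v + d *: u) :: l) =
  (b * d - a * c) * G (v :: u :: l).
Proof.
have alt w : G (w :: w :: l) = 0 by exact: (altG.2 [::]).
have linr w := alternating_formD (alternating_form_cons altG w) l.
(* Vanishing on a repeated [u + v] gives antisymmetry. *)
have := alt (1 *: u + 1 *: v).
rewrite !(alternating_formD altG) !linr !alt.
rewrite !mul1r addr0 add0r => /eqP; rewrite addr_eq0 => /eqP ->.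
by ring.
Qed.

Definition phi_prod (F : fieldType) (z : F) (y s : nat -> F) (m : nat) : F :=
  \prod_(j < m) ((z - s j ^- 2 * y j) / (z - y j)).

(** When [z] is the row parameter, the factor is the weight of an empty vertex, so [phi_prod] is the
    weight of [m] columns without paths. *)
Lemma phi_prodS (F : fieldType) (z : F) (y s : nat -> F) m :
  phi_prod z y s m.+1 =
  (s m ^- 2 * y m - z) / (y m - z) * phi_prod z y s m.
Proof.
rewrite /phi_prod big_ord_recr /= mulrC; congr (_ * _).
by rewrite -[LHS]mulrNN -invrN !opprB.
Qed.

(** * The sum over one row, column by column *)

Section Row.
Variables (F : fieldType) (V : lmodType F).
Variables (x r : F) (y s : nat -> F) (v u : nat -> V).

(** The recursion removes the last column, so [h] is the edge to the right of the first [m] columns,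
    and the base case is the empty left boundary. The [v q] of the occupied top edges reach [G] in
    decreasing order of [q]. *)
Fixpoint row_sum (P : nat -> bool) (m : nat) (h : bool) (G : seq V -> F) : F :=
  if m is m'.+1 then
    \sum_(q : bool) \sum_(h' : bool)
      What (P m') h' q h x (y m') r (s m') *
      row_sum P m' h' (if q then fun l => G (v m' :: l) else G)
  else if h then 0 else G [::].

(* [D v_m]; the diagonal form is [dvec_row]. *)
Definition dvec (m : nat) : V :=
  ((r ^- 2 * x - y m) / (y m - x)) *: v m
  + (x * (r ^- 2 - 1) / (y m - x)) *: u m.

(** The sign counts the entries after the removed one, not before it, so prepending a position keeps
    the signs of the earlier terms. *)
Fixpoint contraction (L : seq nat) (G : seq V -> F) : F :=
  if L is p :: L' then
    contraction L' (fun l => G (dvec p :: l)) +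
    (-1) ^+ size L' * (x * (r ^- 2 - 1) * phi p x y s)
      * G [seq dvec q | q <- L']
  else 0.

Lemma contraction_lin L k1 k2 (G1 G2 G : seq V -> F) :
  (forall l, G l = k1 * G1 l + k2 * G2 l) ->
  contraction L G = k1 * contraction L G1 + k2 * contraction L G2.
Proof.
elim: L G1 G2 G => [|p L IH] G1 G2 G GE /=; first by rewrite !mulr0 addr0.
rewrite (IH (fun l => G1 (dvec p :: l)) (fun l => G2 (dvec p :: l))) // GE.
by ring.
Qed.

Hypothesis r0 : r != 0.
Hypothesis s0 : forall m, s m != 0.
Hypothesis yx : forall m, y m - x != 0.
Hypothesis uS : forall m,
  u m.+1 = ((s m ^- 2 * y m - x) / (y m - x)) *: u m
           + (y m * (s m ^- 2 - 1) / (y m - x)) *: v m.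

(** The coefficients in [uS] are the weights of (0,0;0,0) and (0,1;1,0), those in [dvec] the weights
    of (1,1;1,1) and (1,0;0,1). Hence three of the four cases follow by linearity; only a vertical
    path with empty horizontal edges needs a relation between the weights. *)
Lemma row_sumE P m G : alternating_form G ->
  let L := decr_positions P m in
  row_sum P m true G = contraction L G /\
  row_sum P m false G =
    (-1) ^+ size L * phi_prod x y s m * G [seq dvec q | q <- L]
    + contraction L (fun l => G (u m :: l)).
Proof.
elim: m G => [|m IH] G altG /=.
  by rewrite /phi_prod big_ord0 expr0 !mul1r addr0.
rewrite decr_positionsS !big_bool /=.
have altv := alternating_form_cons altG (v m).
have [IH1 IH0] := IH _ altG; have [IHv1 IHv0] := IH _ altv.
have phiE : phi m x y s = phi_prod x y s m / (y m - x) by rewrite /phi mulrC.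
have yxm := yx m; have sm0 := s0 m.
case: (P m) => /=; rewrite ?mul0r ?add0r ?addr0 ?mul1r.
- split.
    rewrite IHv1 IH0 [X in _ = X + _](contraction_lin _
      (k1 := (r ^- 2 * x - y m) / (y m - x))
      (k2 := x * (r ^- 2 - 1) / (y m - x)) (G1 := fun l => G (v m :: l))
      (G2 := fun l => G (u m :: l))); last by move=> l; rewrite alternating_formD.
    by rewrite phiE; field; rewrite yxm r0.
  rewrite IHv0 phi_prodS phiE uS.
  set L := decr_positions P m; set W := map _ _.
  rewrite [(-1) ^+ _.+1]exprS.
  set a := (s m ^- 2 * y m - x) / (y m - x).
  set c2 := y m * (s m ^- 2 - 1) / (y m - x).
  set c1 := x * (r ^- 2 - 1) / (y m - x).
  set d := (r ^- 2 * x - y m) / (y m - x).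
  set b2 := (_ - _) / _.
  (* Free fermion relation, (0,1;0,1) having weight 1: the weight [b2] of (1,0;1,0) is the
     coefficient of [v m] wedge [u m] in [u m.+1] wedge [dvec m]. *)
  have ff : b2 = c2 * c1 - a * d.
    by rewrite /b2 /c2 /c1 /a /d; field; rewrite yxm r0 sm0.
  rewrite [X in _ = _ + (X + _)](contraction_lin _ (k1 := b2) (k2 := 0)
      (G1 := fun l => G (v m :: u m :: l)) (G2 := fun l => 0)); last first.
    by move=> l; rewrite /dvec -/d -/c1 alternating_form_comb2 // ff; ring.
  (* Outside the contraction the [u m] terms cancel, and the same relation gives the coefficient of
     the [v m] terms. *)
  rewrite /dvec !(alternating_formD altG) -/d -/c1 ff.
  have -> : x * (r ^- 2 - 1) * (phi_prod x y s m / (y m - x)) =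
            c1 * phi_prod x y s m.
    by rewrite /c1; field; rewrite yxm r0.
  by ring.
- split=> //.
  rewrite IH0 IHv1 phi_prodS uS [X in _ = _ + X](contraction_lin _
    (k1 := (s m ^- 2 * y m - x) / (y m - x))
    (k2 := y m * (s m ^- 2 - 1) / (y m - x))
      (G1 := fun l => G (u m :: l)) (G2 := fun l => G (v m :: l))).
    by ring.
  by move=> l; rewrite alternating_formD.
Qed.

End Row.

(** * Determinants of lists of vectors and the Laplace expansion *)

(** The value 0 on lists of the wrong length makes this a form on all lists, and conservation of the
    number of paths needs no separate argument. *)
Definition det_seq (F : fieldType) (n : nat) (l : seq 'rV[F]_n) : F :=
  if size l == n then \det (\matrix_(i < n, j < n) nth 0 l i 0 j) else 0.

Lemma det_seq_alternating (F : fieldType) (n : nat) :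
  alternating_form (@det_seq F n).
Proof.
split.
  suff lin (l1 l2 : seq 'rV[F]_n) k (u v : 'rV[F]_n) :
      det_seq (l1 ++ (k *: u + v) :: l2) =
      k * det_seq (l1 ++ u :: l2) + det_seq (l1 ++ v :: l2) by exact: lin.
  rewrite /det_seq !size_cat /=; case: eqP => sE; last by rewrite mulr0 addr0.
  have i0P : (size l1 < n)%N by lia.
  rewrite -[X in _ = _ + X]mul1r.
  have nth_l2 i w : nth 0 (l1 ++ w :: l2) (bump (size l1) i) =
                    nth 0 (l1 ++ l2) i.
    rewrite !nth_cat /bump; case: (leqP (size l1) i) => h /=.
      by rewrite add1n ltnNge leqW //= subSn.
    by rewrite add0n h.
  apply: (@determinant_multilinear _ _ _ _ _ (Ordinal i0P)); apply/matrixP=> i j;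
    by rewrite !mxE ?nth_l2 // !nth_cat ltnn subnn /= !mxE mul1r.
suff alt (l1 l2 : seq 'rV[F]_n) u : det_seq (l1 ++ u :: u :: l2) = 0.
  by exact: alt.
rewrite /det_seq size_cat /=; case: eqP => // sE.
have i1P : (size l1 < n)%N by lia.
have i2P : ((size l1).+1 < n)%N by lia.
apply: (@determinant_alternate _ _ _ (Ordinal i1P) (Ordinal i2P)).
  by rewrite -(inj_eq val_inj) /= neq_ltn ltnSn.
move=> j; rewrite !mxE !nth_cat /= ltnn subnn ifF; last by apply/negbTE; lia.
by rewrite subSn // subnn.
Qed.

Definition det_phi (F : fieldType) (n : nat) (x : 'I_n -> F) (y s : nat -> F)
    (L : seq nat) : F :=
  det_seq [seq \row_i phi p (x i) y s | p <- L].

Section Laplace.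
Variables (F : fieldType) (V : lmodType F).
Variables (x r : F) (y s : nat -> F) (v u : nat -> V).

Lemma contractionE L (G : seq V -> F) :
  contraction x r y s v u L G =
  \sum_(k < size L)
    (-1) ^+ (size L - k.+1) * (x * (r ^- 2 - 1) * phi (nth 0 L k) x y s)
    * G [seq dvec x r y v u q | q <- take k L ++ drop k.+1 L].
Proof.
elim: L G => [|p L IH] G /=; first by rewrite big_ord0.
rewrite IH big_ord_recl /= subSS subn0 drop0 addrC; congr (_ + _).
Qed.
End Laplace.

Section RowStep.
Variables (F : fieldType) (n : nat) (x : 'I_n.+1 -> F) (r : F) (y s : nat -> F).
Hypothesis r0 : r != 0.
Hypothesis s0 : forall m, s m != 0.
Hypothesis yx : forall m i, y m - x i != 0.
Hypothesis xx : forall i : 'I_n, x (lift ord0 i) - x ord0 != 0.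

Definition row_vec (m : nat) : 'rV[F]_n := \row_i phi m (x (lift ord0 i)) y s.

Definition row_aux (m : nat) : 'rV[F]_n :=
  \row_i (phi_prod (x (lift ord0 i)) y s m / (x (lift ord0 i) - x ord0)).

(** Partial fractions: for [z] one of the other variables, the new factor of [phi_prod] at [z] minus
    its value at [x ord0], divided by [z - x ord0], is the second coefficient divided by
    [y m - z]. *)
Lemma row_auxS m :
  row_aux m.+1 =
  ((s m ^- 2 * y m - x ord0) / (y m - x ord0)) *: row_aux m
  + (y m * (s m ^- 2 - 1) / (y m - x ord0)) *: row_vec m.
Proof.
apply/rowP=> i; rewrite !mxE phi_prodS /phi -/(phi_prod _ y s m).
by field; rewrite !yx s0 xx.
Qed.

(** As [phi_prod z y s m] is [(y m - z) * phi m z y s], [row_aux m] is a diagonal multiple of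
    [row_vec m]. In the sum [y m] cancels, so the diagonal operator is the same for all [m]. *)
Lemma dvec_row m :
  dvec (x ord0) r y row_vec row_aux m =
  \row_i ((r ^- 2 * x ord0 - x (lift ord0 i)) / (x (lift ord0 i) - x ord0)
          * phi m (x (lift ord0 i)) y s).
Proof.
apply/rowP=> i; rewrite !mxE /phi -/(phi_prod _ y s m).
by field; rewrite !yx r0 xx.
Qed.

(** The expansion is along column [ord0], and the determinant of the diagonal operator comes out of
    each minor. The scalar [x ord0 * (r ^- 2 - 1)] is the factor [i = ord0] of the numerator. *)
Lemma contraction_det L :
  contraction (x ord0) r y s row_vec row_aux L (@det_seq F n) =
  (\prod_(i < n.+1) (r ^- 2 * x ord0 - x i))
  / (\prod_(i < n) (x ord0 - x (lift ord0 i))) * det_phi x y s L.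
Proof.
rewrite contractionE /det_phi {2}/det_seq size_map.
case: eqP => [sL|nsL]; last first.
  rewrite mulr0 big1 // => k _; rewrite /det_seq size_map size_cat size_take size_drop.
  have := ltn_ord k => kL; rewrite kL.
  by case: eqP => e; rewrite ?mulr0 //; lia.
rewrite sL (expand_det_col _ ord0) mulr_sumr; apply: eq_bigr => k _.
rewrite /cofactor addn0 !mxE (nth_map 0%N) ?sL // mxE.
pose d := \row_(i < n)
  ((r ^- 2 * x ord0 - x (lift ord0 i)) / (x (lift ord0 i) - x ord0)).
set A := \matrix_(i, j) _.
have -> : det_seq [seq dvec (x ord0) r y row_vec row_aux q
                  | q <- take k L ++ drop k.+1 L]
          = \prod_(i < n) d 0 i * \det (row' k (col' ord0 A)).
  have kL := ltn_ord k.
  have sz : size (take k L ++ drop k.+1 L) = n.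
    by rewrite size_cat size_take size_drop sL kL; lia.
  rewrite /det_seq size_map sz eqxx -det_diag mulrC -det_mulmx mul_mx_diag.
  congr (\det _).
  apply/matrixP => i j; rewrite !mxE (nth_map 0%N) ?sz // (nth_map 0%N); last first.
    by rewrite sL; exact: (ltn_ord (lift k i)).
  rewrite dvec_row !mxE mulrC; congr (phi _ _ _ _ * _).
  rewrite nth_cat size_take sL kL /= /bump; case: (leqP k i) => ki.
    by rewrite nth_drop add1n; congr nth; lia.
  by rewrite nth_take // add0n.
rewrite big_ord_recl.
have -> : \prod_(i < n) d 0 i
  = (-1) ^+ n * ((\prod_(i < n) (r ^- 2 * x ord0 - x (lift ord0 i)))
     / \prod_(i < n) (x ord0 - x (lift ord0 i))).
  rewrite -prodf_div -[n in (-1) ^+ n]card_ord -prodrN; apply: eq_bigr => i _.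
  by rewrite mxE -[RHS]mulrN -invrN opprB.
have kn : (k <= n)%N by rewrite -ltnS.
(* Reversing the differences in the diagonal gives this sign; multiplied by the sign counted from
   the end of [L], it leaves the cofactor sign. *)
have -> : (-1) ^+ n = (-1) ^+ (n.+1 - k.+1) * (-1) ^+ k :> F.
  by rewrite -exprD subSS subnK.
set S := (-1) ^+ (n.+1 - _).
have SS : S * S = 1 by rewrite -expr2 sqrr_sign.
set sk := (-1) ^+ k; set p1 := \prod_(i < n) _; set p2 := _ / _.
set f := phi _ _ _ _; set DD := \det _.
transitivity (S * S * (x ord0 * (r ^- 2 - 1) * f * (sk * p2) * DD)).
  by ring.
by rewrite SS /p2; ring.
Qed.
End RowStep.
Lemma row_sum_det (F : fieldType) (n : nat) (x : 'I_n.+1 -> F) (r : F)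
    (y s : nat -> F) (r0 : r != 0) (s0 : forall m, s m != 0)
    (yx : forall m i, y m - x i != 0)
    (xx : forall i : 'I_n, x (lift ord0 i) - x ord0 != 0) (P : nat -> bool) m :
  row_sum (x ord0) r y s (row_vec x y s) P m true (@det_seq F n) =
  (\prod_(i < n.+1) (r ^- 2 * x ord0 - x i))
  / (\prod_(i < n) (x ord0 - x (lift ord0 i)))
  * det_phi x y s (decr_positions P m).
Proof.
rewrite -contraction_det //.
have H := row_sumE (x := x ord0) (u := row_aux x y s) r0 s0 (yx^~ ord0).
by have [] := H _ (row_auxS s0 yx xx) P m _ (@det_seq_alternating F n).
Qed.

(** * Edge states of a row as finite functions *)

(** Used at [ord_max] to split off the last column of a row, and at [ord0] to split off the bottom
    row of a stack. *)
Definition ffun_insert n (T : finType) (k : 'I_n.+1) (b : T)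
    (g : {ffun 'I_n -> T}) : {ffun 'I_n.+1 -> T} :=
  [ffun i => oapp g b (unlift k i)].

Lemma ffun_insertK n (T : finType) (k : 'I_n.+1) b (g : {ffun 'I_n -> T}) :
  ffun_insert k b g k = b.
Proof. by rewrite ffunE unlift_none. Qed.

Lemma ffun_insert_lift n (T : finType) (k : 'I_n.+1) b (g : {ffun 'I_n -> T}) i :
  ffun_insert k b g (lift k i) = g i.
Proof. by rewrite ffunE liftK. Qed.

Lemma big_ffun_insert (R : Type) (idx : R) (op : Monoid.com_law idx) n
    (T : finType) (k : 'I_n.+1) (E : {ffun 'I_n.+1 -> T} -> R) :
  \big[op/idx]_f E f =
  \big[op/idx]_b \big[op/idx]_(g : {ffun 'I_n -> T}) E (ffun_insert k b g).
Proof.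
rewrite pair_bigA /=.
rewrite (reindex (fun p : T * {ffun 'I_n -> T} => ffun_insert k p.1 p.2)) //.
exists (fun f : {ffun 'I_n.+1 -> T} =>
          (f k, [ffun i : 'I_n => f (lift k i)])) => [[b g] _|f _] /=.
  rewrite ffun_insertK; congr (_, _); apply/ffunP=> i.
  by rewrite ffunE ffun_insert_lift.
apply/ffunP=> i; rewrite ffunE; case: unliftP => [j|] -> //=.
by rewrite ffunE.
Qed.

Definition row_state (m : nat) := {ffun 'I_m -> bool * bool}.

Definition top_edge m (a : row_state m) (i : nat) : bool :=
  oapp (fun k : 'I_m => (a k).1) false (insub i).

(** Index 0 is the empty left boundary. Past column [m] the default is occupied, while that of
    [top_edge] is empty: this is the state far to the right. *)
Definition right_edge m (a : row_state m) (i : nat) : bool :=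
  if i is i'.+1 then oapp (fun k : 'I_m => (a k).2) true (insub i') else false.

Arguments right_edge : simpl never.

Lemma insub_ord n i (h : (i < n)%N) : insub i = Some (Ordinal h).
Proof. exact: insubT. Qed.

Lemma insub_ord_ge n i : (n <= i)%N -> insub i = None :> option 'I_n.
Proof. by move=> h; rewrite insubF // ltnNge h. Qed.

Lemma top_edge_insert m (a : row_state m) b i : (i < m)%N ->
  top_edge (ffun_insert ord_max b a) i = top_edge a i.
Proof.
move=> im; rewrite /top_edge (insub_ord im) (insub_ord (leqW im)) /=.
rewrite (_ : Ordinal _ = lift ord_max (Ordinal im)) ?ffun_insert_lift //.
by apply: val_inj; rewrite /= /bump leqNgt im.
Qed.

Lemma top_edge_insert_max m (a : row_state m) b :
  top_edge (ffun_insert ord_max b a) m = b.1.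
Proof.
rewrite /top_edge (insub_ord (ltnSn m)) /=.
by rewrite (_ : Ordinal _ = ord_max) ?ffun_insertK //; apply: val_inj.
Qed.

Lemma right_edge_insert m (a : row_state m) b i : (i <= m)%N ->
  right_edge (ffun_insert ord_max b a) i = right_edge a i.
Proof.
case: i => // i im; rewrite /right_edge (insub_ord im) (insub_ord (leqW im)) /=.
rewrite (_ : Ordinal _ = lift ord_max (Ordinal im)) ?ffun_insert_lift //.
by apply: val_inj; rewrite /= /bump leqNgt im.
Qed.

Lemma right_edge_insert_max m (a : row_state m) b :
  right_edge (ffun_insert ord_max b a) m.+1 = b.2.
Proof.
rewrite /right_edge (insub_ord (ltnSn m)) /=.
by rewrite (_ : Ordinal _ = ord_max) ?ffun_insertK //; apply: val_inj.
Qed.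

Lemma prod_ord_le (R : comNzRingType) n (f : 'I_n.+1 -> 'I_n.+1 -> R) :
  \prod_(i < n.+1) \prod_(j < n.+1 | (i <= j)%N) f i j =
  (\prod_(j < n.+1) f ord0 j) *
  \prod_(i < n) \prod_(j < n | (i <= j)%N) f (lift ord0 i) (lift ord0 j).
Proof.
rewrite big_ord_recl; congr (_ * _); apply: eq_bigr => i _.
by rewrite big_mkcond big_ord_recl /= mul1r [RHS]big_mkcond.
Qed.

Lemma prod_ord_lt (R : comNzRingType) n (f : 'I_n.+1 -> 'I_n.+1 -> R) :
  \prod_(i < n.+1) \prod_(j < n.+1 | (i < j)%N) f i j =
  (\prod_(j < n) f ord0 (lift ord0 j)) *
  \prod_(i < n) \prod_(j < n | (i < j)%N) f (lift ord0 i) (lift ord0 j).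
Proof.
rewrite big_ord_recl; congr (_ * _).
  by rewrite big_mkcond big_ord_recl /= mul1r.
apply: eq_bigr => i _.
by rewrite big_mkcond big_ord_recl /= mul1r [RHS]big_mkcond.
Qed.

(** * Stacking the rows of a finite strip *)

Section Rows.
Variables (F : fieldType) (y s : nat -> F).

Definition row_weight (x r : F) (P : nat -> bool) m (a : row_state m) : F :=
  \prod_(i < m) What (P i) (right_edge a i) (top_edge a i) (right_edge a i.+1)
                     x (y i) r (s i).

(** Splitting the last column off a state matches one step of the recursion. *)
Lemma row_sum_states (V : lmodType F) (x r : F) (v : nat -> V) P m h
    (G : seq V -> F) :
  row_sum x r y s v P m h G =
  \sum_(a : row_state m | right_edge a m == h)
    row_weight x r P a * G [seq v p | p <- decr_positions (top_edge a) m].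
Proof.
elim: m h G => [|m IH] h G /=.
  rewrite big_mkcond (eq_bigr (fun=> if h then 0 else G [::])); last first.
    by move=> a _; rewrite /row_weight big_ord0 mul1r /decr_positions /=; case: h.
  by rewrite sumr_const card_ffun card_ord expn0.
have row_weight_insert (a : row_state m) b :
    row_weight x r P (ffun_insert ord_max b a) =
    row_weight x r P a * What (P m) (right_edge a m) b.1 b.2 x (y m) r (s m).
  rewrite /row_weight big_ord_recr /= right_edge_insert // top_edge_insert_max.
  rewrite right_edge_insert_max; congr (_ * _); apply: eq_bigr => i _.
  by rewrite !right_edge_insert ?top_edge_insert // ltnW.
have positions_insert (a : row_state m) b :
    decr_positions (top_edge (ffun_insert ord_max b a)) m.+1 =
    if b.1 then m :: decr_positions (top_edge a) m
    else decr_positions (top_edge a) m.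
  rewrite decr_positionsS top_edge_insert_max; congr (if _ then _ :: _ else _);
    apply: eq_in_filter => i; rewrite mem_rev mem_iota => /andP[_ im];
    by rewrite top_edge_insert.
rewrite [RHS]big_mkcond (big_ffun_insert _ ord_max) /=.
pose E q h' := \sum_(a : row_state m)
  (if h' == h then
     row_weight x r P a * What (P m) (right_edge a m) q h' x (y m) r (s m)
     * G [seq v p | p <- if q then m :: decr_positions (top_edge a) m
                         else decr_positions (top_edge a) m]
   else 0).
rewrite [RHS](eq_bigr (fun b => E b.1 b.2)); last first.
  move=> b _; apply: eq_bigr => a _.
  by rewrite right_edge_insert_max row_weight_insert positions_insert.
rewrite -(pair_bigA _ E) /=.
apply: eq_bigr => q _; rewrite [RHS](bigD1 h) //=.
rewrite [X in _ = _ + X]big1 ?addr0; last first.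
  by move=> h' /negbTE hh; rewrite /E hh big1.
(* The states are sorted by the edge entering the last column from the left, the [h'] of the
   recursion. *)
rewrite /E eqxx (partition_big (fun a => right_edge a m) predT) //=.
apply: eq_bigr => h' _; rewrite IH mulr_sumr; apply: eq_bigr => a /eqP ->.
by case: q; rewrite /= mulrCA mulrA.
Qed.

(* The states of the vertical edges below row [j], where the last value of [j]
   stands for the top boundary. *)
Definition below m n (P : nat -> bool) (t : {ffun 'I_n -> row_state m})
    (j : 'I_n.+1) : nat -> bool :=
  oapp (fun k => top_edge (t k)) P (unlift ord0 j).

(** The boundary conditions not built into [row_state]: a path leaves each row on the right, and
    none leaves at the top. *)
Definition admissible m n (P : nat -> bool) (t : {ffun 'I_n -> row_state m}) :
    bool :=
  [forall j, right_edge (t j) m] && [forall i : 'I_m, ~~ below P t ord_max i].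

Definition stack_weight m n (x r : 'I_n -> F) (P : nat -> bool)
    (t : {ffun 'I_n -> row_state m}) : F :=
  \prod_(j < n) row_weight (x j) (r j) (below P t (widen_ord (leqnSn n) j)) (t j).

Lemma below_insert0 m n (P : nat -> bool) a (t : {ffun 'I_n -> row_state m}) :
  below P (ffun_insert ord0 a t) ord0 = P.
Proof. by rewrite /below unlift_none. Qed.

Lemma below_insert_lift m n (P : nat -> bool) a (t : {ffun 'I_n -> row_state m}) j :
  below P (ffun_insert ord0 a t) (lift ord0 j) = below (top_edge a) t j.
Proof.
rewrite /below liftK /=; case: (unliftP ord0 j) => [k ->|->] /=.
  by rewrite ffun_insert_lift.
by rewrite ffun_insertK.
Qed.

Lemma admissible_insert m n (P : nat -> bool) a (t : {ffun 'I_n -> row_state m}) :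
  admissible P (ffun_insert ord0 a t) =
  right_edge a m && admissible (top_edge a) t.
Proof.
rewrite /admissible andbA; congr (_ && _).
  apply/forallP/andP => [H|[Ha /forallP H] j].
    split; first by have := H ord0; rewrite ffun_insertK.
    by apply/forallP => j; have := H (lift ord0 j); rewrite ffun_insert_lift.
  by case: (unliftP ord0 j) => [k|] ->; rewrite ?ffun_insert_lift ?ffun_insertK.
apply: eq_forallb => i; have -> : ord_max = lift ord0 (@ord_max n) by exact: val_inj.
by rewrite below_insert_lift.
Qed.

Lemma stack_weight_insert m n (x r : 'I_n.+1 -> F) (P : nat -> bool) a
    (t : {ffun 'I_n -> row_state m}) :
  stack_weight x r P (ffun_insert ord0 a t) =
  row_weight (x ord0) (r ord0) P a *
  stack_weight (fun i => x (lift ord0 i)) (fun i => r (lift ord0 i))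
    (top_edge a) t.
Proof.
rewrite /stack_weight big_ord_recl; congr (_ * _).
  rewrite ffun_insertK (_ : widen_ord _ _ = ord0) ?below_insert0 //; exact: val_inj.
apply: eq_bigr => j _; rewrite ffun_insert_lift.
have -> : widen_ord (leqnSn n.+1) (lift ord0 j) =
          lift ord0 (widen_ord (leqnSn n) j) by exact: val_inj.
by rewrite below_insert_lift.
Qed.

(** Induction on the rows with [P] arbitrary: once the bottom row is split off, its top edges are
    the boundary of the rest. The rest sums to a determinant in the [row_vec], and [row_sum_det]
    sums this over the bottom row. *)
Lemma sum_stack_weight n (x r : 'I_n -> F) P m
    (r0 : forall j, r j != 0) (s0 : forall i, s i != 0)
    (yx : forall i j, y i != x j) (xx : forall i j, i != j -> x i != x j) :
  \sum_(t : {ffun 'I_n -> row_state m} | admissible P t) stack_weight x r P t =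
  (\prod_(i < n) \prod_(j < n | (i <= j)%N) (r i ^- 2 * x i - x j))
  / (\prod_(i < n) \prod_(j < n | (i < j)%N) (x i - x j))
  * det_phi x y s (decr_positions P m).
Proof.
elim: n x r P r0 yx xx => [|n IH] x r P r0 yx xx.
  rewrite !big_ord0 invr1 mulr1 mul1r big_mkcond.
  (* Without rows, both sides are 1 if [P] is empty below [m] and 0 otherwise. *)
  rewrite (eq_bigr (fun=> if [forall i : 'I_m, ~~ P i] then 1 else 0)); last first.
    move=> t _; rewrite /stack_weight big_ord0 /admissible /below.
    rewrite (_ : unlift _ _ = None) /=; last by case: unliftP => // -[].
    by rewrite (_ : [forall j, _] = true) //; apply/forallP => -[].
  rewrite sumr_const card_ffun card_ord expn0.
  rewrite /det_phi /det_seq size_map size_filter -leqn0 leqNgt -has_count det_mx00.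
  rewrite has_rev -all_predC (_ : all _ _ = [forall i : 'I_m, ~~ P i]) //.
  apply/allP/forallP => H i; first by apply: H; rewrite mem_iota add0n ltn_ord.
  by rewrite mem_iota => /andP[_ im]; exact: (H (Ordinal im)).
rewrite big_mkcond (big_ffun_insert _ ord0) /=.
under eq_bigr => a _.
  rewrite -big_mkcond /=; under eq_bigl do rewrite admissible_insert.
  under eq_bigr do rewrite stack_weight_insert.
  over.
rewrite (bigID (fun a : row_state m => right_edge a m)) /=.
rewrite [X in _ + X]big1 ?addr0; last first.
  by move=> a /negbTE ->; rewrite big_pred0.
set C := _ / _.
have xx' (i j : 'I_n) : i != j -> x (lift ord0 i) != x (lift ord0 j).
  by move=> ij; rewrite xx // (inj_eq lift_inj).
set x' := fun i => x (lift ord0 i) in xx'; set r' := fun i => r (lift ord0 i).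
under eq_bigr => a ra.
  rewrite ra /= -mulr_sumr IH //; last by move=> i; exact: r0.
  over.
rewrite /C prod_ord_le prod_ord_lt -/x'.
set C1 := \prod_(i < n) \prod_(j < n | _) _.
set C2 := \prod_(i < n) \prod_(j < n | _) _.
have yx' i j : y i - x j != 0 by rewrite subr_eq0.
have xx0 (i : 'I_n) : x (lift ord0 i) - x ord0 != 0.
  by rewrite subr_eq0 xx // eq_sym neq_lift.
transitivity (C1 / C2 *
  row_sum (x ord0) (r ord0) y s (row_vec x y s) P m true (@det_seq F n)).
  rewrite row_sum_states mulr_sumr; under [RHS]eq_bigl do rewrite eqb_id.
  by apply: eq_bigr => a _; rewrite mulrCA.
by rewrite row_sum_det // [(\prod_(j < n) _ * C2)^-1]invfM; ring.
Qed.

End Rows.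

(** * Reduction of the infinite sum to the first [m] columns *)

Section Truncation.
Variables (F : fieldType) (N : nat) (x r : 'I_N -> F) (y s : nat -> F).
Variables (lam : N.-tuple nat) (m : nat).

Let P (i : nat) : bool := `[< sigset lam i.+1 >].

Hypothesis sig_bound : forall i, (m <= i)%N -> P i = false.

Implicit Types t : {ffun 'I_N -> row_state m}.

Definition stack_config (t : {ffun 'I_N -> row_state m}) : config N :=
  (fun i j => below P t j i, fun i j => right_edge (t j) i).

Definition config_stack (c : config N) : {ffun 'I_N -> row_state m} :=
  [ffun j => [ffun k : 'I_m => (c.1 k (lift ord0 j), c.2 k.+1 j)]].

Lemma below_lift t j : below P t (lift ord0 j) = top_edge (t j).
Proof. by rewrite /below liftK. Qed.

Lemma below_ge t j i : (m <= i)%N -> below P t j i = false.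
Proof.
move=> mi; case: (unliftP ord0 j) => [k|] ->.
  by rewrite below_lift /top_edge insub_ord_ge.
by rewrite /below unlift_none /= sig_bound.
Qed.

Lemma right_edge_gt (a : row_state m) i : (m < i)%N -> right_edge a i = true.
Proof. by case: i => // i mi; rewrite /right_edge insub_ord_ge. Qed.

Lemma right_edge_ge t j i :
  admissible P t -> (m <= i)%N -> right_edge (t j) i = true.
Proof.
move=> /andP[/forallP H _]; rewrite leq_eqVlt => /predU1P[<-|/right_edge_gt //].
exact: H.
Qed.

Lemma vertex_weight_stack t i j :
  vertex_weight x y r s (stack_config t) (i, j) =
  What (below P t (widen_ord (leqnSn N) j) i) (right_edge (t j) i)
    (top_edge (t j) i) (right_edge (t j) i.+1) (x j) (y i) (r j) (s i).
Proof. by rewrite /vertex_weight /= below_lift. Qed.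

Lemma vertex_weight_ge t i j : admissible P t -> (m <= i)%N ->
  vertex_weight x y r s (stack_config t) (i, j) = 1.
Proof.
move=> adm mi; rewrite vertex_weight_stack !right_edge_ge ?leqW // below_ge //.
by rewrite -below_lift below_ge.
Qed.

Lemma stack_weightE t :
  stack_weight y s x r P t =
  \prod_(j < N) \prod_(i < m) vertex_weight x y r s (stack_config t) (i : nat, j).
Proof.
apply: eq_bigr => j _; apply: eq_bigr => i _; by rewrite vertex_weight_stack.
Qed.

Lemma config_weight_stack t : admissible P t ->
  config_weight x y r s (stack_config t) = stack_weight y s x r P t.
Proof.
move=> adm; rewrite /config_weight stack_weightE; case: asboolP => [[[i j] w0]|_].
  (* A vertex of weight 0 lies in the first [m] columns, so the finite product vanishes too. *)
  have im : (i < m)%N.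
    rewrite ltnNge; apply/negP => mi; move: w0; rewrite vertex_weight_ge //.
    by move/eqP; rewrite oner_eq0.
  by rewrite (bigD1 j) //= (bigD1 (Ordinal im)) //= w0 !mul0r.
rewrite (@fsbigE _ _ _ _ _ [seq (i, j) | j <- enum 'I_N, i <- iota 0 m]) //.
- rewrite big_mkcond big_allpairs_dep /= big_enum /=; apply: eq_bigr => j _.
  rewrite -[X in iota 0 X]subn0 -/(index_iota 0 m) big_mkord.
  apply: eq_bigr => i _; by rewrite in_setT.
- apply: allpairs_uniq; rewrite ?enum_uniq ?iota_uniq //.
  by move=> [j1 i1] [j2 i2] _ _ [-> ->].
- move=> [i j] _ nin; apply: vertex_weight_ge => //.
  rewrite leqNgt; apply: contra nin => im; apply/allpairsP; exists (j, i).
  by rewrite mem_enum mem_iota.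
Qed.

(** With bottom edge empty and right edge occupied, only (0,1;0,1) has nonzero weight, so emptiness
    propagates up the column. *)
Lemma column_forced (c : config N) i :
  (forall j, vertex_weight x y r s c (i, j) != 0) ->
  c.1 i ord0 = false -> (forall j, c.2 i.+1 j = true) ->
  (forall j, c.1 i j = false) /\ (forall j, c.2 i j = true).
Proof.
move=> w0 c10 c2.
have step j : c.1 i (widen_ord (leqnSn N) j) = false ->
    c.1 i (lift ord0 j) = false /\ c.2 i j = true.
  move=> e; have := w0 j; rewrite /vertex_weight /= e c2.
  by case: (c.2 i j); case: (c.1 i (lift ord0 j)); rewrite /= ?eqxx.
have c1 j : c.1 i j = false.
  case: j => k; elim: k => [|k IH] kN.
    by rewrite -[RHS]c10; congr (c.1 i _); exact: val_inj.
  have kN' : (k < N)%N by [].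
  rewrite (_ : Ordinal kN = lift ord0 (Ordinal kN')); last exact: val_inj.
  suff /step[] : c.1 i (widen_ord (leqnSn N) (Ordinal kN')) = false by [].
  by rewrite (_ : widen_ord _ _ = Ordinal (ltnW kN)) ?IH //; exact: val_inj.
by split=> // j; have [] := step j (c1 _).
Qed.

Lemma boundary_stack t : admissible P t -> boundary lam (stack_config t).
Proof.
move=> adm; split=> /=.
- by move=> i; rewrite /below unlift_none /=; split=> /asboolP.
- move=> i; case: (leqP m i) => im; first by rewrite below_ge.
  by move: adm => /andP[_ /forallP/(_ (Ordinal im))/negbTE].
- by [].
- by exists m => //= i mi j; rewrite right_edge_ge.
Qed.

Lemma boundary_weight_neq0 c : boundary lam c -> config_weight x y r s c != 0 ->
  c = stack_config (config_stack c) /\ admissible P (config_stack c).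
Proof.
move=> [c10 c1N c20 [K _ cK]] w0.
have wv i j : vertex_weight x y r s c (i, j) != 0.
  apply/eqP => e; move: w0; rewrite /config_weight ifT ?eqxx //.
  by apply/asboolP; exists (i, j).
have c1P i : c.1 i ord0 = P i.
  by rewrite /P; apply/idP/asboolP => /c10.
have c10F i : (m <= i)%N -> c.1 i ord0 = false by move=> mi; rewrite c1P sig_bound.
(* Columns are forced leftwards from [K], past which all horizontal edges are occupied, down to [m];
   [d] bounds the distance to [K]. *)
have c2 d i : (m <= i)%N -> (K <= i + d)%N -> forall j, c.2 i j = true.
  elim: d i => [|d IH] i mi; first by rewrite addn0 => /cK.
  rewrite addnS => Ki.
  have [_] := column_forced (wv i) (c10F i mi) (IH i.+1 (leqW mi) Ki).
  exact.
have c2T i j : (m <= i)%N -> c.2 i j = true.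
  by move=> mi; apply: (c2 K) => //; rewrite leq_addl.
have c1F i j : (m <= i)%N -> c.1 i j = false.
  move=> mi; have [] := column_forced (wv i) (c10F i mi) => [k|//].
  by rewrite c2T ?leqW.
have E : c = stack_config (config_stack c).
  rewrite [LHS]surjective_pairing /stack_config.
  congr pair; apply/funext=> i; apply/funext=> j.
    case: (unliftP ord0 j) => [k|] ->; last by rewrite /below unlift_none c1P.
    rewrite below_lift /top_edge ffunE; case: (leqP m i) => im.
      by rewrite insub_ord_ge //= c1F.
    by rewrite (insub_ord im) /= ffunE.
  case: i => [|i]; first by rewrite c20.
  rewrite /right_edge ffunE; case: (leqP m i) => im.
    by rewrite insub_ord_ge //= c2T // leqW.
  by rewrite (insub_ord im) /= ffunE.
split=> //; apply/andP; split; apply/forallP => j.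
  by rewrite -[right_edge _ _]/((stack_config (config_stack c)).2 m j) -E c2T.
by rewrite -[below _ _ _ _]/((stack_config (config_stack c)).1 j ord_max) -E c1N.
Qed.

Lemma stack_configK : cancel stack_config config_stack.
Proof.
move=> t; apply/ffunP=> j; apply/ffunP=> k; rewrite !ffunE /= below_lift.
rewrite /top_edge /right_edge (insub_ord (ltn_ord k)) /=.
by rewrite (_ : Ordinal _ = k) -?surjective_pairing //; exact: val_inj.
Qed.

(** Every nonzero term lies in the image of the admissible stacks under the injective
    [stack_config], so the sum can be reindexed. *)
Lemma partition_fun_stack :
  partition_fun lam x y r s =
  \sum_(t : {ffun 'I_N -> row_state m} | admissible P t) stack_weight y s x r P t.
Proof.
rewrite /partition_fun.
rewrite -(@fsbig_widen _ _ _ _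
  (stack_config @` [set` [pred t | admissible P t]])%classic); first last.
- move=> c /= [bc nc]; apply/eqP/negPn/negP.
  move=> /(boundary_weight_neq0 bc) [e adm].
  by apply: nc; exists (config_stack c).
- by move=> _ [t adm <-]; exact: boundary_stack.
rewrite fsbig_image; last by move=> t1 t2 _ _ /(can_inj stack_configK).
rewrite -(@bigfs _ _ _ _ (index_enum _)) ?index_enum_uniq //; last first.
  by move=> t _; rewrite mem_index_enum.
by apply: eq_bigr => t; exact: config_weight_stack.
Qed.

End Truncation.

(** * Positions of a signature and the determinant formula *)

(** Strictly decreasing lists with the same elements are equal. Positions start at 0 and [sigset] at
    1, hence [j.+1]. *)
Lemma decr_positions_sigset N (lam : N.-tuple nat) m :
  is_signature lam -> (forall j, tnth lam j + N <= m)%N ->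
  decr_positions (fun i => `[< sigset lam i.+1 >]) m =
  [seq (tnth lam j + N - j.+1)%N | j <- enum 'I_N].
Proof.
move=> slam lam_m; apply: (@irr_sorted_eq _ gtn).
- by move=> a b c /= ? ?; lia.
- by move=> a /=; rewrite ltnn.
- apply: sorted_filter; first by move=> a b c /= ? ?; lia.
  by rewrite rev_sorted; exact: iota_ltn_sorted.
- have nthE k : (k < N)%N ->
      nth 0%N [seq (tnth lam j + N - j.+1)%N | j <- enum 'I_N] k =
      (nth 0 lam k + N - k.+1)%N.
    move=> kN; rewrite (nth_map (Ordinal kN)) ?size_enum_ord //.
    by rewrite (tnth_nth 0%N) nth_enum_ord.
  apply/(sortedP 0%N) => i; rewrite size_map size_enum_ord => iN.
  rewrite (nthE _ iN) (nthE _ (ltnW iN)) /=.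
  have := (sortedP 0%N slam) i; rewrite size_tuple => /(_ iN) /=; lia.
move=> i; rewrite mem_filter mem_rev mem_iota add0n /=.
apply/andP/mapP => [[/asboolP [j e] im]|[j _ ->]].
  exists j; rewrite ?mem_enum //; have := ltn_ord j; lia.
have jN := ltn_ord j; have := lam_m j; split; last by lia.
by apply/asboolP; exists j; lia.
Qed.

Theorem theorem1p5 (R : realType) (N : nat) (lam : N.-tuple nat)
    (x r : 'I_N -> R[i]) (y s : nat -> R[i])
    (hlam : is_signature lam)
    (hr : forall j, r j != 0)
    (hs : forall i, s i != 0)
    (hyx : forall i j, y i != x j)
    (hx : forall i j : 'I_N, i != j -> x i != x j) :
  partition_fun lam x y r s =
    (\prod_(i < N) \prod_(j < N | (i <= j)%N) (r i ^- 2 * x i - x j))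
    / (\prod_(i < N) \prod_(j < N | (i < j)%N) (x i - x j))
    * \det (\matrix_(i < N, j < N) phi (tnth lam j + N - j.+1) (x i) y s).
Proof.
(* No element of [sigset lam] exceeds [m], so no path enters from below past the first [m]
   columns. *)
pose m := (\max_(j < N) (tnth lam j + N))%N.
have lam_m j : (tnth lam j + N <= m)%N by exact: (leq_bigmax j).
rewrite (@partition_fun_stack _ _ _ _ _ _ _ m); last first.
  move=> i mi; apply/asboolP => -[j e]; have := lam_m j; lia.
rewrite sum_stack_weight // decr_positions_sigset // /det_phi /det_seq 2!size_map.
(* In [det_phi] the positions index the rows, hence the transpose. *)
rewrite size_enum_ord eqxx -det_tr; congr (_ * \det _).
apply/matrixP=> i j; rewrite !mxE -map_comp (nth_map i) ?size_enum_ord //=.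
by rewrite mxE nth_ord_enum.
Qed.
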